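(* Let $G$ and $H$ be $m$-edge coloured graphs (with the same underlying graph) and let $\Gamma\subseteq S_m$ be a group acting transitively on $\{1,\dots,m\}$. Then $G$ and $H$ are $\Gamma$-switch equivalent if and only if $G^{\Gamma}$ and $H^{\Gamma}$ are $\Gamma^{ab}$-switch equivalent.
   Context: An $m$-edge coloured graph is a finite simple graph with each edge coloured from $\{1,\dots,m\}$. Switching at a vertex $v$ w.r.t. $\pi$ replaces the colour $c$ of each edge at $v$ by $\pi(c)$; two coloured graphs are $\Gamma$-switch equivalent if one is obtained from the other by a finite sequence of switches with elements of $\Gamma$. Let $[\Gamma,\Gamma]$ be the commutator subgroup of $\Gamma$, and for a colour $i$ let $\Delta(i)=\{\tau(i):\tau\in[\Gamma,\Gamma]\}$ be its orbit; the distinct orbits $D=\{\Delta(1),\dots,\Delta(m)\}$ form a block system for $\Gamma$, and we regard these $m'$ orbits as new colours. The Abelianization $G^\Gamma$ of $G$ is obtained by recolouring every edge of colour $i$ with colour $\Delta(i)$. The Abelianization $\Gamma^{ab}$ of $\Gamma$ is the group of permutations of $D$ induced by $\Gamma$, i.e. each $\pi\in\Gamma$ (equivalently, its coset $\pi[\Gamma,\Gamma]$) induces $\pi':\Delta(i)\mapsto\Delta(\pi(i))$, and elements of $\Gamma/[\Gamma,\Gamma]$ acting identically on $D$ are identified; $\Gamma^{ab}$ is an Abelian group acting transitively on $D$. Switching $G^\Gamma$ at $u$ w.r.t. $\pi'$ changes the colour $\Delta(i)$ of each edge at $u$ to $\pi'(\Delta(i))=\Delta(\pi(i))$; $\Gamma^{ab}$-switch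 equivalence is defined accordingly. *)

(* Defs.v *)
From mathcomp Require Import all_boot all_fingroup all_solvable.

Set Implicit Arguments.
Unset Strict Implicit.
Unset Printing Implicit Defensive.

Local Open Scope group_scope.

(* [G x y] is [None] when [x] and [y] are not adjacent, and [Some c] when
   they are joined by an edge of colour [c].  No colour is stored for a
   non-edge, so Leibniz equality is equality of edge-coloured graphs. *)
Record colgraph (V C : finType) := ColGraph {
  ecol :> {ffun V -> {ffun V -> option C}};
  col_sym : [forall x, forall y, ecol x y == ecol y x];
  col_irr : [forall x, ecol x x == None] }.

Definition adj (V C : finType) (G : colgraph V C) : rel V :=
  fun x y => isSome (G x y).

Lemma colP (V C : finType) (G H : colgraph V C) :
  (forall x y, G x y = H x y) -> G = H.
Proof.
case: G H => [g sg ig] [h sh ih] /= eqGH.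
have eq_gh : g = h by apply/ffunP => x; apply/ffunP.
by case: h / eq_gh sh ih eqGH => sh ih _; congr ColGraph; apply: bool_irrelevance.
Qed.

Lemma colC (V C : finType) (G : colgraph V C) x y : G x y = G y x.
Proof. by have /forallP/(_ x)/forallP/(_ y)/eqP := col_sym G. Qed.

Lemma colxx (V C : finType) (G : colgraph V C) x : G x x = None.
Proof. by have /forallP/(_ x)/eqP := col_irr G. Qed.

Section Operations.

Variables V C C' : finType.

Definition recolour_fun (f : C -> C') (G : colgraph V C) :=
  [ffun x => [ffun y => omap f (G x y)]].

Fact recolour_sym f G :
  [forall x, forall y, recolour_fun f G x y == recolour_fun f G y x].
Proof. by apply/forallP => x; apply/forallP => y; rewrite !ffunE colC. Qed.

Fact recolour_irr f G : [forall x, recolour_fun f G x x == None].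
Proof. by apply/forallP => x; rewrite !ffunE colxx. Qed.

Definition recolour f G := ColGraph (recolour_sym f G) (recolour_irr f G).

Definition switch_fun (G : colgraph V C) (v : V) (p : {perm C}) :=
  [ffun x => [ffun y =>
    if (x == v) || (y == v) then omap p (G x y) else G x y]].

Fact switch_sym G v p :
  [forall x, forall y, switch_fun G v p x y == switch_fun G v p y x].
Proof.
by apply/forallP => x; apply/forallP => y; rewrite !ffunE orbC colC.
Qed.

Fact switch_irr G v p : [forall x, switch_fun G v p x x == None].
Proof. by apply/forallP => x; rewrite !ffunE colxx if_same. Qed.

Definition switch G v p := ColGraph (switch_sym G v p) (switch_irr G v p).

Definition switch_seq (G : colgraph V C) (s : seq (V * {perm C})) :=
  foldl (fun G' vp => switch G' vp.1 vp.2) G s.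

Definition switch_equiv (Gam : {group {perm C}}) (G H : colgraph V C) :=
  exists2 s : seq (V * {perm C}),
    all (fun vp => vp.2 \in Gam) s & switch_seq G s = H.

End Operations.

Lemma switchK (V C : finType) (G : colgraph V C) v p :
  switch (switch G v p) v p^-1 = G.
Proof.
apply: colP => x y; rewrite !ffunE; case: (_ || _) => //.
by case: (G x y) => //= c; rewrite permK.
Qed.

Lemma switch_equiv_sym (V C : finType) (Gam : {group {perm C}})
  (G H : colgraph V C) : switch_equiv Gam G H -> switch_equiv Gam H G.
Proof.
case=> s sGam <-; elim/last_ind: s sGam => [|s [v p] IHs]; first by exists [::].
rewrite all_rcons /= => /andP[Gp /IHs[t tGam eq_t]].
exists ((v, p^-1) :: t); first by rewrite /= groupV Gp.
by rewrite /switch_seq foldl_rcons /= switchK.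
Qed.

Section Abelianization.

Variables (C : finType) (Gam : {group {perm C}}).

Definition Delta (i : C) : {set C} := orbit 'P [~: Gam, Gam] i.

Definition blocks : {set {set C}} := [set Delta i | i : C].

Definition block := {B : {set C} | B \in blocks}.

Fact Delta_blocks i : Delta i \in blocks.
Proof. exact: imset_f. Qed.

Definition block_of (i : C) : block := exist _ (Delta i) (Delta_blocks i).

Lemma block_ofP (B : block) : exists i, B = block_of i.
Proof. by case: B => B /[dup] /imsetP[i _ ->] Bi; exists i; apply: val_inj. Qed.

Lemma block_of_eq i j :
  (block_of i == block_of j) = (i \in orbit 'P [~: Gam, Gam] j).
Proof. by rewrite -val_eqE /= orbit_eq_mem. Qed.

Lemma block_of_perm p i j :
  p \in Gam -> (block_of (p i) == block_of (p j)) = (block_of i == block_of j).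
Proof.
move=> Gp; have sub q k l : q \in Gam ->
    block_of k = block_of l -> block_of (q k) = block_of (q l).
  move=> Gq /eqP; rewrite block_of_eq => /orbitP[t Rt <-].
  apply/eqP; rewrite block_of_eq; apply/orbitP; exists (t ^ q).
    by rewrite memJ_norm // (subsetP (commg_norml Gam Gam)).
  by rewrite /= /aperm conjgE !permM permK.
apply/eqP/eqP; last exact: sub.
by move/(sub p^-1 _ _ (groupVr Gp)); rewrite !permK.
Qed.

(* Permutations of the blocks are taken as such, so elements of the quotient
   of [Gam] by its commutator subgroup acting identically on the blocks are
   identified; [ab_induced] shows that each [p \in Gam] contributes one. *)
Definition ab_set : {set {perm block}} :=
  [set s : {perm block} | [exists p in Gam, forall i, s (block_of i) == block_of (p i)]].

Lemma ab_setP (s : {perm block}) :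
  reflect (exists2 p, p \in Gam & forall i, s (block_of i) = block_of (p i))
          (s \in ab_set).
Proof.
rewrite inE; apply: (iffP existsP) => [[p /andP[Gp /forallP sp]] | [p Gp sp]].
  by exists p => // i; apply/eqP.
by exists p; rewrite Gp; apply/forallP => i; rewrite sp.
Qed.

Lemma ab_induced p : p \in Gam ->
  exists! s : {perm block}, forall i, s (block_of i) = block_of (p i).
Proof.
move=> Gp; have exB B : exists i, block_of i == B.
  by have [i ->] := block_ofP B; exists i.
pose f B := block_of (p (xchoose (exB B))).
have fE i : f (block_of i) = block_of (p i).
  by apply/eqP; rewrite block_of_perm //; apply: (xchooseP (exB (block_of i))).
have f_inj : injective f.
  move=> B1 B2; have [[i ->] [j ->]] := (block_ofP B1, block_ofP B2).
  by rewrite !fE => /eqP; rewrite block_of_perm // => /eqP.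
exists (perm f_inj); split=> [i | t tE]; first by rewrite permE fE.
by apply/permP => B; have [i ->] := block_ofP B; rewrite permE fE tE.
Qed.

Fact ab_group_set : group_set ab_set.
Proof.
apply/group_setP; split; first by apply/ab_setP; exists 1 => // i; rewrite !perm1.
move=> s t /ab_setP[p Gp sp] /ab_setP[q Gq tq]; apply/ab_setP.
by exists (p * q); [rewrite groupM | move=> i; rewrite !permM sp tq].
Qed.

Definition ab_group : {group {perm block}} := Group ab_group_set.

Lemma ab_group_abelian : abelian ab_group.
Proof.
apply/centsP => s /ab_setP[p Gp sp] t /ab_setP[q Gq tq].
apply/permP => B; have [i ->] := block_ofP B.
rewrite !permM sp !tq sp; apply/eqP; rewrite block_of_eq.
apply/orbitP; exists [~ p, q]; first by rewrite mem_commg.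
by rewrite /= /aperm -!permM mulgA -commgC.
Qed.

Lemma ab_group_trans :
  [transitive Gam, on [set: C] | 'P] ->
  [transitive ab_group, on [set: block] | 'P].
Proof.
move=> trG; have [i0 _ _] := imsetP trG.
apply/imsetP; exists (block_of i0); first exact: in_setT.
apply/setP => B; rewrite in_setT; apply/esym/orbitP; have [i ->] := block_ofP B.
have [p Gp ->] := atransP2 trG (in_setT i0) (in_setT i).
have [s [sE _]] := ab_induced Gp.
by exists s; [apply/ab_setP; exists p | apply: sE].
Qed.

End Abelianization.

Definition abelianization (V C : finType) (Gam : {group {perm C}})
  (G : colgraph V C) : colgraph V (block Gam) := recolour (block_of Gam) G.

(* Main.v *)
(** Switching [x] by [p^-1], [y] by [q^-1], [x] by [p] and [y] by [q] changes no
    edge other than [xy], whose colour undergoes the commutator of [p] and [q].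
    Hence the colour of a single edge can be moved freely inside its orbit
    under the commutator subgroup.  So, after lifting a sequence of switches of
    the Abelianizations to [Gam], the remaining discrepancies with [H] can be
    repaired one edge at a time. *)
Require Import Defs.
From mathcomp Require Import all_boot all_fingroup.

Set Implicit Arguments.
Unset Strict Implicit.
Unset Printing Implicit Defensive.

Local Open Scope group_scope.

Section SwitchEquiv.

Variables (V C : finType) (Gam : {group {perm C}}).
Implicit Types G H K : colgraph V C.

Lemma switch_equiv_refl G : switch_equiv Gam G G.
Proof. by exists [::]. Qed.

Lemma switch_equiv_trans G H K :
  switch_equiv Gam G H -> switch_equiv Gam H K -> switch_equiv Gam G K.
Proof.
case=> s sGam <- [t tGam <-]; exists (s ++ t); first by rewrite all_cat sGam.
by rewrite /switch_seq foldl_cat.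
Qed.

Lemma switch_equiv_switch G v p :
  p \in Gam -> switch_equiv Gam G (switch G v p).
Proof. by move=> Gp; exists [:: (v, p)]; rewrite //= Gp. Qed.

(** The pair is unordered, since the colour of an edge is stored at both of its orientations. *)
Definition same_edge (x y u v : V) :=
  (u == x) && (v == y) || (u == y) && (v == x).

Lemma switch_commg G (x y u v : V) (p q : {perm C}) : x != y ->
  switch (switch (switch (switch G x p^-1) y q^-1) x p) y q u v =
  if same_edge x y u v then omap [~ p, q] (G u v) else G u v.
Proof.
move=> neq_xy; rewrite !ffunE /same_edge.
have [<-|neq_uv] := eqVneq u v; first by rewrite colxx !if_same.
case: (G u v) => [c|]; last by rewrite !if_same.
have [eq_ux|_] := eqVneq u x.
  subst u; rewrite (negbTE neq_xy) (eq_sym v x) (negbTE neq_uv) orbF /=.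
  case: eqVneq => _ //=; last by rewrite permKV.
  (* Products of permutations act from left to right, so on [xy] the four switches compose to
     [p^-1 * q^-1 * p * q], which is [[~ p, q]]. *)
  by rewrite commgEl conjgE !permM.
have [eq_uy|_] := eqVneq u y.
  subst u; rewrite (eq_sym v y) (negbTE neq_uv) /=.
  case: eqVneq => _ //=; last by rewrite permKV.
  by rewrite commgEl conjgE !permM.
rewrite /=; have [->|_] := eqVneq v x; last by case: eqVneq; rewrite //= permKV.
by rewrite (negbTE neq_xy) /= permKV.
Qed.

(** In a finite group, an element of the commutator subgroup is a product of commutators, without
    inverses; each factor costs four switches. *)
Lemma switch_equiv_recolour_edge G (x y : V) (t : {perm C}) :
    x != y -> t \in [~: Gam, Gam] ->
  exists2 G', switch_equiv Gam G G' &
    forall u v, G' u v = if same_edge x y u v then omap t (G u v) else G u v.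
Proof.
move=> neq_xy /gen_prodgP[n [c cR ->]] {t}; move: G.
(* Quantifying over [G] lets the second factor act on the graph already altered by the first. *)
pose P (t : {perm C}) := forall G, exists2 G', switch_equiv Gam G G' &
  forall u v, G' u v = if same_edge x y u v then omap t (G u v) else G u v.
suffices: P (\prod_(i < n) c i) by apply.
apply: (big_ind P) => [G | s t IHs IHt G | i _ G].
- exists G; first exact: switch_equiv_refl.
  by move=> u v; case: ifP => // _; case: (G u v) => //= a; rewrite perm1.
- have [G1 G_G1 G1E] := IHs G; have [G2 G1_G2 G2E] := IHt G1.
  exists G2; first exact: switch_equiv_trans G1_G2.
  move=> u v; rewrite G2E G1E; case: (same_edge x y u v) => //.
  by case: (G u v) => //= a; rewrite permM.
have /imset2P[p q Gp Gq ->] := cR i.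
exists (switch (switch (switch (switch G x p^-1) y q^-1) x p) y q).
  apply: switch_equiv_trans (switch_equiv_switch _ _ Gq).
  apply: switch_equiv_trans (switch_equiv_switch _ _ Gp).
  apply: switch_equiv_trans (switch_equiv_switch _ _ (groupVr Gq)).
  exact: switch_equiv_switch (groupVr Gp).
by move=> u v; apply: switch_commg.
Qed.

(** Induction on the number of ordered pairs where [G] and [H] differ: repairing one edge lowers it
    and keeps the Abelianization. *)
Lemma abelianization_eq_switch_equiv G H :
  abelianization Gam G = abelianization Gam H -> switch_equiv Gam G H.
Proof.
pose diff G := [set e : V * V | G e.1 e.2 != H e.1 e.2].
have [n] := ubnP #|diff G|; elim: n G => // n IHn G lt_diff eq_ab.
have eq_block u v :
    omap (block_of Gam) (G u v) = omap (block_of Gam) (H u v).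
  have := congr1 (fun K : colgraph V (block Gam) => K u v) eq_ab.
  by rewrite !ffunE.
have [diff0|[[x y]]] := set_0Vmem (diff G).
  rewrite (_ : G = H); first exact: switch_equiv_refl.
  apply: colP => u v; apply/eqP.
  by have /setP/(_ (u, v)) := diff0; rewrite !inE => /negPn.
rewrite inE /= => neq_GH.
have neq_xy : x != y.
  by apply: contraNneq neq_GH => ->; rewrite !colxx.
(* Equal Abelianizations have the same edges, so the discrepancy is between two colours of one
   block. *)
have := eq_block x y; case Gxy: (G x y) => [c|]; case Hxy: (H x y) => [d|] //=;
  last by rewrite Gxy Hxy in neq_GH.
move/Some_inj/esym/eqP; rewrite block_of_eq.
case/orbitP=> t Rt tc; rewrite /= /aperm in tc.
have [G' G_G' G'E] := switch_equiv_recolour_edge G neq_xy Rt.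
have G'H u v : same_edge x y u v -> G' u v = H u v.
  rewrite G'E => /[dup] uv ->.
  case/orP: uv => /andP[/eqP-> /eqP->];
    by rewrite 1?(colC G y) 1?(colC H y) Gxy Hxy /= tc.
apply: switch_equiv_trans G_G' _; apply: IHn.
  rewrite ltnS in lt_diff; apply: leq_trans lt_diff; apply: proper_card.
  apply/properP; split.
    apply/subsetP=> -[u v]; rewrite !inE /=.
    by have := @G'H u v; rewrite G'E; case: ifP => // _ /(_ isT) ->; rewrite eqxx.
  by exists (x, y); rewrite !inE ?neq_GH //= G'H ?eqxx // /same_edge !eqxx.
apply: colP => u v; rewrite !ffunE.
by case uv: (same_edge x y u v); [rewrite G'H | rewrite G'E uv eq_block].
Qed.

Lemma abelianization_switch G v (p : {perm C}) (s : {perm block Gam}) :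
    (forall i, s (block_of Gam i) = block_of Gam (p i)) ->
  abelianization Gam (switch G v p) = switch (abelianization Gam G) v s.
Proof.
move=> sp; apply: colP => x y; rewrite !ffunE; case: ifP => // _.
by case: (G x y) => //= c; rewrite sp.
Qed.

Lemma switch_equiv_abelianization G H : switch_equiv Gam G H ->
  switch_equiv (ab_group Gam) (abelianization Gam G) (abelianization Gam H).
Proof.
case=> s sGam <-; elim: s G sGam => [|[v p] s IHs] G /=.
  by exists [::].
case/andP=> Gp /(IHs (switch G v p)); have [q [qp _]] := ab_induced Gp.
rewrite (abelianization_switch _ _ qp) => -[t tGam eq_t].
exists ((v, q) :: t) => //=; rewrite tGam andbT.
by apply/ab_setP; exists p.
Qed.

(** Every element of [ab_group Gam] is induced by some [p] in [Gam], so the switches lift one at a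
    time. *)
Lemma switch_equiv_lift G (K : colgraph V (block Gam)) :
    switch_equiv (ab_group Gam) (abelianization Gam G) K ->
  exists2 G', switch_equiv Gam G G' & abelianization Gam G' = K.
Proof.
case=> s sGam <-; elim: s G sGam => [|[v q] s IHs] G /=.
  by exists G => //; apply: switch_equiv_refl.
case/andP=> /ab_setP[p Gp qp] /(IHs (switch G v p))[G' GG' eqG'].
exists G'; last by rewrite eqG' (abelianization_switch _ _ qp).
exact: switch_equiv_trans (switch_equiv_switch _ _ Gp) GG'.
Qed.

End SwitchEquiv.

Theorem theorem3p2 (m : nat) (V : finType) (Gam : {group {perm 'I_m}})
    (G H : colgraph V 'I_m) :
  [transitive Gam, on [set: 'I_m] | 'P] ->
  adj G =2 adj H ->
  switch_equiv Gam G H <->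
  switch_equiv (ab_group Gam) (abelianization Gam G) (abelianization Gam H).
Proof.
move=> _ _; split=> [|/switch_equiv_lift[G' GG' eqG']].
  exact: switch_equiv_abelianization.
(* The lifted graph [G'] agrees with [H] only up to blocks; the edge repairs close the gap. *)
exact: switch_equiv_trans GG' (abelianization_eq_switch_equiv eqG').
Qed.
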